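(* Let $T$ be a binary tree on $n\geq 12$ vertices and let $h$ be the smallest positive integer such that $\lceil\frac{n}{4}\rceil\leq 2^h-1$. Then $$d_T(C(T),C_d(T))\leq \left\lfloor \frac{n}{4}\right\rfloor - \left\lfloor\frac{\lfloor \frac{n}{4}\rfloor+1+h}{2}\right\rfloor,$$ and equality holds if $T\cong T_{rg}^{n,l}$ where $l=2\lceil\frac{n}{4}\rceil+1$.
   Context: All graphs are finite, simple, connected and undirected. A pendant vertex is a vertex of degree $1$. A binary tree is a tree in which every non-pendant vertex has degree $3$ (so its number of vertices is even). Center and centroid: the eccentricity of $v\in V(T)$ is $e(v)=\max_{u}d_T(u,v)$; the center $C(T)$ is the set of vertices of minimum eccentricity. A branch at $v$ is a maximal subtree of $T$ containing $v$ as a pendant vertex; the weight of $v$ is the maximum number of edges in a branch at $v$; the centroid $C_d(T)$ is the set of vertices of minimum weight. For $X,Y\subseteq V(T)$, $d_T(X,Y)=\min\{d_T(x,y):x\in X,y\in Y\}$. Rooted binary trees: a rooted binary tree is a rooted tree whose root has degree $2$ and in which every other vertex has degree $1$ or $3$; the single-vertex rooted tree is also allowed. The height (level) of a vertex is its distance to the root. A rooted binary tree is ordered if the vertices of each level $l\ge 1$ are linearly ordered so that two vertices at level $l+1$ with different parents are ordered as their parents are at level $l$. A rooted binary tree is rgood if (i) the heights of any two of its pendant vertices differ by at most $1$, and (ii) it can be ordered so that the parents of the pendant vertices at the highest level form a final segment in the ordering of the vertices at the next-to-highest level. For each odd $l$ there is, up to isomorphism, exactly one rgood binary tree on $l$ vertices,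 denoted $T_{rg}^l$. Crg trees: a binary caterpillar is a binary tree having a path such that every vertex not on the path is adjacent to a vertex of the path. For even $n\ge 4$ and odd $l$ with $3\le l<n$, the crg tree $T_{rg}^{n,l}$ is the tree on $n$ vertices obtained by identifying the root of $T_{rg}^l$ with a vertex of maximum eccentricity of a binary caterpillar on $n-l+1$ vertices. *)

(* Defs.v *)
From mathcomp Require Import all_boot.
Set Implicit Arguments.
Unset Strict Implicit.
Unset Printing Implicit Defensive.

Definition ceil_divn (m d : nat) : nat := (m + d.-1) %/ d.

Section Graph.
Variables (V : finType) (e : rel V).

(* All cycles: closed walks without repeated vertices, of length >= 3. *)
Definition acyclic : Prop := forall c : seq V, ucycle e c -> size c < 3.

Definition tree : Prop :=
  [/\ symmetric e, irreflexive e, 0 < #|V|, forall x y, connect e x y & acyclic].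

Definition deg (v : V) : nat := #|[set u | e v u]|.

Definition pendant (v : V) : bool := deg v == 1.

Definition binary_tree : Prop :=
  tree /\ forall v, ~~ pendant v -> deg v = 3.

(* The least length of a walk from x to y.  In a connected graph it is < #|V|;
   the junk value for disconnected x and y is #|V|. *)
Definition dist (x y : V) : nat :=
  find (fun k => [exists p : k.-tuple V, path e x p && (last x p == y)])
       (iota 0 #|V|).

Definition ecc (v : V) : nat := \max_(u : V) dist u v.

Definition center : {set V} := [set v | [forall u, ecc v <= ecc u]].

Definition induced (U : {set V}) : rel V :=
  [rel x y | [&& x \in U, y \in U & e x y]].

Definition connected_on (U : {set V}) : bool :=
  (U != set0) && [forall x in U, forall y in U, connect (induced U) x y].

(* A subtree of a tree is the subgraph induced by its vertex set, so subtrees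
   are represented by the vertex sets that induce a connected subgraph. *)
Definition subtree_pendant (v : V) (U : {set V}) : bool :=
  [&& v \in U, connected_on U & #|[set u in U | e v u]| == 1].

Definition branch (v : V) (U : {set V}) : bool := maxset (subtree_pendant v) U.

Definition edges (U : {set V}) : {set {set V}} :=
  [set [set x; y] | x in U, y in U & e x y].

Definition weight (v : V) : nat :=
  \max_(U : {set V} | branch v U) #|edges U|.

Definition centroid : {set V} := [set v | [forall u, weight v <= weight u]].

(* Minimum over X * Y; the default #|V| is irrelevant for nonempty X and Y
   since distances never exceed it. *)
Definition set_dist (X Y : {set V}) : nat :=
  \big[minn/#|V|]_(x in X) \big[minn/#|V|]_(y in Y) dist x y.

Definition binary_caterpillar : Prop :=
  binary_tree /\
  exists (x : V) (p : seq V),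
    [/\ path e x p, uniq (x :: p) &
        forall v, v \notin x :: p -> exists2 u, u \in x :: p & e v u].

End Graph.

Section Rooted.
Variables (V : finType) (e : rel V) (r : V).

Definition height (v : V) : nat := dist e r v.

Definition level (l : nat) : pred V := [pred v | height v == l].

Definition max_height : nat := \max_(v : V) height v.

Definition parent (p v : V) : bool := e p v && (height v == (height p).+1).

Definition rooted_binary_tree : Prop :=
  tree e /\
  (#|V| = 1 \/
   deg e r = 2 /\ forall v, v != r -> deg e v = 1 \/ deg e v = 3).

(* [le] is only meaningful between vertices of the same level; it carries the
   linear orders of all the levels at once. *)
Definition level_ordering (le : rel V) : Prop :=
  (forall l, [/\ {in level l &, total le},
                 {in level l &, antisymmetric le} &
                 {in level l & &, transitive le}]) /\
  (forall p q u v, parent p u -> parent q v -> height u = height v ->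
     p != q -> le u v = le p q).

Definition top_parent (x : V) : bool :=
  [exists u, [&& parent x u, pendant e u & height u == max_height]].

Definition rgood : Prop :=
  [/\ rooted_binary_tree,
      forall u v, pendant e u -> pendant e v -> height u <= height v + 1 &
      exists2 le : rel V, level_ordering le &
        forall x y, (height x).+1 = max_height -> (height y).+1 = max_height ->
          le x y -> top_parent x -> top_parent y].

End Rooted.

(* Disjoint union of (V1, e1) and (V2, e2) with c2 identified with c1: the
   merged vertex is [inl c1], and c2 is removed from V2. *)
Definition glue (V1 V2 : finType) (e1 : rel V1) (e2 : rel V2) (c1 : V1) (c2 : V2) :
    rel (V1 + {y : V2 | y != c2}) :=
  fun a b =>
    match a, b with
    | inl x, inl x' => e1 x x'
    | inr y, inr y' => e2 (val y) (val y')
    | inl x, inr y => (x == c1) && e2 c2 (val y)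
    | inr y, inl x => (x == c1) && e2 (val y) c2
    end.

Arguments glue {V1 V2} e1 e2 c1 c2 _ _.

Definition isomorphic (V W : finType) (e : rel V) (f : rel W) : Prop :=
  exists2 phi : V -> W, bijective phi & forall x y, f (phi x) (phi y) = e x y.

(* (V, e) is isomorphic to T_rg^{n,l} (for even n >= 4 and odd l, 3 <= l < n).
   Since T_rg^l, the caterpillar and the gluing vertex are unique only up to
   isomorphism, any choice of them is accepted. *)
Definition iso_crg (n l : nat) (V : finType) (e : rel V) : Prop :=
  exists (R : finType) (eR : rel R) (r : R)
         (K : finType) (eK : rel K) (c : K),
    [/\ rgood eR r, #|R| = l,
        binary_caterpillar eK /\ #|K| = n - l + 1,
        forall u, ecc eK u <= ecc eK c &
        isomorphic e (glue eK eR c r)].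

(* Main.v *)
Require Import Defs.
From mathcomp Require Import all_boot all_order all_algebra.
From mathcomp Require Import zify.

(* Let [k = n %/ 4].  At a centroid vertex [v] nearest to the center, the side of
   the tree towards the center has fewer than half of the vertices, hence at most
   [2 k - 1] of them because it has odd size; so its vertices are at distance at
   most [k] from [v].  The other side has so many vertices that some of them are
   at distance at least [h] from [v].  If [w] is the nearest center vertex, at
   distance [d > 0], then [ecc w >= d + h], and this eccentricity is attained
   beyond [w], so [k >= d + ecc w >= 2 d + h].
   In the crg tree the gluing vertex [c] is the only centroid vertex.  The
   caterpillar contains a path of length [D >= k] from [c], and its vertex at
   distance [(k - h) %/ 2] from [c] has eccentricity at most [D - (k - h) %/ 2];
   no vertex nearer to [c] can do as well. *)

Set Implicit Arguments.
Unset Strict Implicit.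
Unset Printing Implicit Defensive.

(** * Distances as lengths of shortest walks *)

Section Distance.
Variables (V : finType) (e : rel V).

Lemma dist_le x p y : path e x p -> last x p = y -> dist e x y <= size p.
Proof.
(* The search defining [dist] never returns more than its default [#|V|], so a walk with at least
   [#|V|] edges needs no witness. *)
move=> ep lp; have [le_p|lt_p] := leqP #|V| (size p).
  by apply: leq_trans le_p; rewrite /dist -{2}(size_iota 0 #|V|) find_size.
rewrite leqNgt; apply/negP => lt_d.
have := before_find 0 lt_d; rewrite nth_iota // add0n.
by move/negbT/existsP; case; exists (in_tuple p); rewrite ep lp /=.
Qed.

(** A duplicate-free path has fewer than [#|V|] edges, so the search succeeds. Shortening the walk
    it finds cannot lower the length below [dist], so that walk yields a duplicate-free path of the
    same length. *)
Lemma dist_path x y : connect e x y ->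
  exists p, [/\ path e x p, uniq (x :: p), last x p = y & size p = dist e x y].
Proof.
case/connectP => q eq yq; case/shortenP: eq yq => p ep Up _ yp {q}.
have ltp : size p < #|V| by have := card_uniqP Up; rewrite /= => <-; apply: max_card.
have hasd : has (fun k => [exists p : k.-tuple V, path e x p && (last x p == y)])
   (iota 0 #|V|).
  apply/hasP; exists (size p); first by rewrite mem_iota.
  by apply/existsP; exists (in_tuple p); rewrite ep -yp /=.
have := nth_find 0 hasd; rewrite nth_iota; last by rewrite -{2}(size_iota 0 #|V|) -has_find.
rewrite add0n => /existsP [q /andP [eq /eqP lq]].
have sz : size q = dist e x y by rewrite size_tuple.
case/shortenP: (eq) lq sz => r er Ur sub lr sz.
exists r; split=> //; apply/eqP; rewrite eqn_leq (dist_le er lr) andbT -sz.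
by apply: uniq_leq_size => //; case/andP: Ur.
Qed.

Lemma dist_xx x : dist e x x = 0.
Proof. by apply/eqP; rewrite -leqn0 (@dist_le x [::] x). Qed.

End Distance.

(** * Unique paths in trees and distances across an edge *)

Section Tree.
Variables (V : finType) (e : rel V).
Hypothesis treeE : tree e.
Local Notation d := (dist e).

Lemma tree_sym : symmetric e. Proof. by case: treeE. Qed.
Lemma tree_irr : irreflexive e. Proof. by case: treeE. Qed.
Lemma tree_connect x y : connect e x y. Proof. by case: treeE. Qed.
Lemma tree_acyclic : acyclic e. Proof. by case: treeE. Qed.

Lemma neq_edge x y : e x y -> x != y.
Proof. by move=> exy; apply/eqP => xy; rewrite xy tree_irr in exy. Qed.

Lemma dist_eq0 x y : (d x y == 0) = (x == y).
Proof.
apply/eqP/eqP => [|->]; last exact: dist_xx.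
by have [[|z p] [_ _ <- <-]] := dist_path (tree_connect x y).
Qed.

Lemma distC x y : d x y = d y x.
Proof.
wlog suff: x y / d x y <= d y x.
  by move=> H; apply/eqP; rewrite eqn_leq !H.
have [p [ep _ lp <-]] := dist_path (tree_connect y x).
rewrite -(size_belast y) -size_rev.
apply: dist_le; last by case: p ep lp => //= a p _ _; rewrite rev_cons last_rcons.
rewrite -lp rev_path; apply: sub_path ep => u v; by rewrite /= tree_sym.
Qed.

Lemma dist_triangle y x z : d x z <= d x y + d y z.
Proof.
have [p [ep _ lp <-]] := dist_path (tree_connect x y).
have [q [eq _ lq <-]] := dist_path (tree_connect y z).
by rewrite -size_cat; apply: dist_le; rewrite ?cat_path ?last_cat lp ?ep.
Qed.

Lemma dist_edge1 x y : e x y -> d x y = 1.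
Proof.
move=> exy; apply/eqP; rewrite eqn_leq (@dist_le _ e x [:: y]) /= ?exy //.
by rewrite lt0n dist_eq0 neq_edge.
Qed.

(* Otherwise the walk from [a] to [b] would close up to a cycle through [x]. *)
Lemma nbr_eq x a b r : e x a -> e x b -> path e a r -> last a r = b ->
  x \notin a :: r -> a = b.
Proof.
move=> exa exb er lr; case/shortenP: er lr => r' er' Ur' sub lr' xr.
have xr' : x \notin a :: r'.
  apply: contra xr; rewrite !inE => /orP [->//|/sub ->]; exact: orbT.
have := @tree_acyclic (x :: a :: r'); rewrite /ucycle [uniq _]/= xr' /=.
rewrite rcons_path lr' exa er' tree_sym exb => /(_ Ur').
by case: r' lr' {er' Ur' sub xr'}.
Qed.

Lemma uniq_path_inj x p q : path e x p -> path e x q -> uniq (x :: p) ->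
  uniq (x :: q) -> last x p = last x q -> p = q.
Proof.
elim: p x q => [|a p IH] x [|b q] //=.
- by move=> _ _ _ /andP [/negP nxq _] xl; case: nxq; rewrite {1}xl mem_last.
- by move=> _ _ /andP [/negP nxp _] _ xl; case: nxp; rewrite -{1}xl mem_last.
move=> /andP [exa ep] /andP [exb eq] /andP [xap Up] /andP [xbq Uq] ll.
have ab : a = b.
  (* The walk goes along [p] to the common end and back along [q] to [b]. It avoids [x], since both
     paths leave [x] for good. *)
  apply: (@nbr_eq x a b (p ++ rev (belast b q))) => //.
  - rewrite cat_path ep ll /= rev_path; apply: sub_path eq => u v.
    by rewrite /= tree_sym.
  - by rewrite last_cat ll; case: (q) => //= c q'; rewrite rev_cons last_rcons.
  rewrite -cat_cons mem_cat mem_rev negb_or xap /=.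
  by apply: contra xbq; apply: mem_belast.
by subst b; congr cons; apply: IH ll.
Qed.

Lemma dist_uniq_path x p : path e x p -> uniq (x :: p) -> d x (last x p) = size p.
Proof.
move=> ep Up; have [q [eq Uq lq <-]] := dist_path (tree_connect x (last x p)).
by rewrite (uniq_path_inj ep eq Up Uq (esym lq)).
Qed.

(** The path from [z] to [x] either passes through [y], which is then its last vertex but one, or
    extends by [y] to a duplicate-free path. So adjacent vertices are never equally far from [z]. *)
Lemma dist_edge z x y : e x y -> d x z = (d y z).+1 \/ d y z = (d x z).+1.
Proof.
move=> exy; rewrite ![d _ z]distC.
have [p [ep Up lp sp]] := dist_path (tree_connect z x).
have [yp|yp] := boolP (y \in z :: p); last first.
  right; have := @dist_uniq_path z (rcons p y).
  rewrite last_rcons size_rcons sp; apply; first by rewrite rcons_path ep lp.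
  by rewrite -rcons_cons rcons_uniq yp.
left; case/splitPl: yp ep Up lp sp => p1 p2 ly.
rewrite -cat_cons cat_path cat_uniq last_cat size_cat ly.
move=> /andP [ep1 ep2] /and3P [Up1 dis Up2] lp <-.
rewrite -ly dist_uniq_path //.
have Uy2 : uniq (y :: p2).
  rewrite /= Up2 andbT; apply: contra dis => yp2; apply/hasP; exists y => //.
  by rewrite -ly mem_last.
by rewrite -(dist_uniq_path ep2 Uy2) lp dist_edge1 ?addn1 // tree_sym.
Qed.

Lemma nbr_toward x z : x != z -> exists2 y, e x y & d x z = (d y z).+1.
Proof.
move=> xz; have [[|y p] [/= ep _ lp sp]] := dist_path (tree_connect x z).
  by rewrite -lp eqxx in xz.
case/andP: ep => exy ep; exists y => //.
have := dist_le ep lp; rewrite -sp => le_d.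
by have [] := dist_edge z exy; lia.
Qed.

(** Shortest paths to [z] from neighbours nearer to [z] avoid [x]. Prefixed with [x], they are
    duplicate-free paths with the same ends, hence equal. *)
Lemma nbr_toward_uniq x y y' z : e x y -> e x y' -> d y z < d x z ->
  d y' z < d x z -> y = y'.
Proof.
move=> exy exy' lt1 lt2.
have [p [ep Up lp sp]] := dist_path (tree_connect y z).
have [q [eq Uq lq sq]] := dist_path (tree_connect y' z).
have Uxp w r : e x w -> d w z < d x z -> path e w r -> uniq (w :: r) -> last w r = z ->
    uniq (x :: w :: r).
  move=> exw ltw er Ur lr; rewrite cons_uniq Ur andbT; apply/negP => xr.
  case/splitPl: xr er Ur lr => r1 r2 lx er Ur lr; have er0 := er.
  move: er lr; rewrite cat_path last_cat lx => /andP [er1 er2] lr.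
  have := dist_le er2 lr; have := dist_uniq_path er0 Ur.
  rewrite last_cat lx lr size_cat; lia.
have E : y :: p = y' :: q.
  apply: (@uniq_path_inj x); rewrite /= ?exy ?exy' //; try exact: Uxp.
  by rewrite lp lq.
by case: E.
Qed.

(** Every path from the side of [x] to the side of [y] crosses the edge between them. The proof
    moves [a] towards [x] by induction. *)
Lemma dist_cut x y a z : e x y -> d x a < d y a -> d y z < d x z ->
  d a z = d x a + 1 + d y z.
Proof.
move=> exy; elim: {a}(d x a) {-2}a (leqnn (d x a)) => [|n IH] a.
  rewrite leqn0 dist_eq0 => /eqP <- _ lt; rewrite dist_xx add0n.
  by have [] := dist_edge z exy; lia.
move=> le_a lt_a lt_z.
have [->|ax] := eqVneq a x.
  by rewrite dist_xx; have [] := dist_edge z exy; lia.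
have [b eab da] := nbr_toward ax.
rewrite ![d _ x]distC in da.
have exy_b : d x b < d y b by have [] := dist_edge y eab; rewrite ![d _ y]distC; lia.
have db := IH b ltac:(lia) exy_b lt_z.
have [] := dist_edge z eab; first by lia.
(* If [a] were nearer to [z] than [b], then [b] would have two neighbours nearer to [z]: besides
   [a], the vertex [y] when [b = x], and otherwise the next vertex [c] towards [x]. *)
move=> dba; exfalso.
have [bx|bx] := eqVneq b x.
  subst b; have ay : a = y.
    by apply: (@nbr_toward_uniq x a y z) => //; rewrite 1?tree_sym //; lia.
  by subst a; rewrite dist_xx in lt_a.
have [c ebc dc] := nbr_toward bx.
rewrite ![d _ x]distC in dc.
have exy_c : d x c < d y c by have [] := dist_edge y ebc; rewrite ![d _ y]distC; lia.
have dcz := IH c ltac:(lia) exy_c lt_z.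
have ac : a = c by apply: (@nbr_toward_uniq b a c z) => //; rewrite 1?tree_sym //; lia.
by subst c; lia.
Qed.

End Tree.

(* For an edge [v w] of a tree, the vertices on the side of [w]. *)
Definition side (V : finType) (e : rel V) (v w : V) : {set V} :=
  [set u | dist e w u < dist e v u].

(** * Recursive structure and size of the sides of an edge *)

Section Sides.
Variables (V : finType) (e : rel V).
Hypothesis treeE : tree e.
Local Notation d := (dist e).
Local Notation side := (side e).

Lemma side_dist v w u : e v w -> u \in side v w -> d v u = (d w u).+1.
Proof. by move=> evw; rewrite inE; have [] := dist_edge treeE u evw; lia. Qed.

Lemma sideC v w : e v w -> side w v = ~: side v w.
Proof.
by move=> evw; apply/setP => u; rewrite !inE; have [] := dist_edge treeE u evw; lia.
Qed.

Lemma card_sideC v w : e v w -> #|side v w| + #|side w v| = #|V|.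
Proof. by move=> evw; rewrite (sideC evw) cardsC. Qed.

Lemma side_root v w : e v w -> w \in side v w.
Proof. by move=> evw; rewrite inE dist_xx (dist_edge1 treeE evw). Qed.

Lemma side_top v w : e v w -> v \notin side v w.
Proof. by move=> evw; rewrite inE dist_xx. Qed.

Lemma side_disjoint v x y : e v x -> e v y -> x != y -> [disjoint side v x & side v y].
Proof.
move=> evx evy xy; rewrite -setI_eq0; apply/eqP/setP => u; rewrite !inE.
apply/negP => /andP [ux uy]; case/eqP: xy.
exact: (nbr_toward_uniq treeE evx evy ux uy).
Qed.

Lemma side_childP v w u : e v w ->
  reflect (u = w \/ exists x, [/\ e w x, x != v & u \in side w x]) (u \in side v w).
Proof.
move=> evw; apply: (iffP idP) => [uv|[->|[x [ewx xv ux]]]]; last 2 first.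
- exact: side_root.
- rewrite inE; have [//|vw] := dist_edge treeE u evw; first by lia.
  case/eqP: xv; apply: (@nbr_toward_uniq _ _ treeE w x v u) => //.
  + by rewrite tree_sym.
  + by rewrite inE in ux.
  + by rewrite vw.
have [->|uw] := eqVneq u w; [by left | right].
rewrite eq_sym in uw; have [x ewx dx] := nbr_toward treeE uw.
exists x; split=> //; last by rewrite inE dx.
by apply/eqP => xv; subst x; rewrite inE dx in uv; lia.
Qed.

Lemma side_pendant v w : e v w -> pendant e w -> side v w = [set w].
Proof.
move=> evw /cards1P [a Na]; apply/setP => u; rewrite in_set1.
apply/side_childP/eqP => // [[//|[x [ewx xv _]]]|->]; last by left.
have := in_set1 x a; have := in_set1 v a; rewrite -Na !inE ewx tree_sym // evw.
by move=> /esym/eqP va /esym/eqP xa; rewrite va xa eqxx in xv.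
Qed.

Lemma side_two v w x y : e v w -> e w x -> e w y -> x != y -> x != v -> y != v ->
    (forall u, e w u -> [|| u == v, u == x | u == y]) ->
  side v w = w |: (side w x :|: side w y) /\
  #|side v w| = (#|side w x| + #|side w y|).+1.
Proof.
move=> evw ewx ewy xy xv yv all3.
have E : side v w = w |: (side w x :|: side w y).
  apply/setP => u; rewrite in_setU1 in_setU; apply/side_childP/idP => //.
    case=> [->|[z [ewz zv uz]]]; first by rewrite eqxx.
    have := all3 z ewz; rewrite (negbTE zv) /=.
    by case/orP => /eqP <-; rewrite uz !orbT.
  case/or3P => [/eqP ->|ux|uy]; first by left.
    by right; exists x.
  by right; exists y.
split=> //; rewrite E cardsU1 cardsU disjoint_setI0 ?cards0 ?subn0 ?side_disjoint //.
by rewrite in_setU !(negbTE (side_top _)).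
Qed.

Lemma nbrs_deg3 v w : e v w -> deg e w = 3 -> exists x y,
  [/\ e w x, e w y, x != y /\ x != v, y != v &
      forall u, e w u -> [|| u == v, u == x | u == y]].
Proof.
rewrite (tree_sym treeE) => ewv; rewrite /deg (cardsD1 v) inE ewv => -[].
move=> /eqP/cards2P [x [y [xy N]]].
have /setP Nx := N; have := Nx x; have := Nx y; rewrite !inE !eqxx orbT /=.
case/andP=> yv ewy /andP [xv ewx]; exists x, y; split=> // u ewu.
by have := Nx u; rewrite !inE ewu andbT; case: eqVneq => //= _ <-.
Qed.

(** Structural induction as for rooted binary trees: a side is a leaf, or a root with the sides of
    its two other neighbours. Degrees are constrained only inside the side, so the principle also
    applies below the root of an rgood tree, which has degree 2. *)
Lemma side_ind (P : V -> V -> Prop) :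
  (forall v w, e v w -> pendant e w -> side v w = [set w] -> P v w) ->
  (forall v w x y, e v w -> e w x -> e w y -> [disjoint side w x & side w y] ->
     side v w = w |: (side w x :|: side w y) ->
     #|side v w| = (#|side w x| + #|side w y|).+1 ->
     P w x -> P w y -> P v w) ->
  forall v w, e v w -> (forall u, u \in side v w -> deg e u = 1 \/ deg e u = 3) ->
  P v w.
Proof.
move=> Pleaf Pnode v w.
elim: {v w}#|side v w| {-2}v {-2}w (leqnn #|side v w|) => [|n IH] v w.
  by rewrite leqn0 cards_eq0 => /eqP E evw; have := side_root evw; rewrite E inE.
move=> le_n evw degs; have [dw|dw] := degs w (side_root evw).
  have pw : pendant e w by rewrite /pendant dw.
  by apply: Pleaf => //; apply: side_pendant.
have [x [y [ewx ewy [xy xv] yv all3]]] := nbrs_deg3 evw dw.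
have [E C] := side_two evw ewx ewy xy xv yv all3.
by apply: (Pnode v w x y) => //; rewrite ?side_disjoint //; apply: IH => //;
  try lia; move=> u ux; apply: degs; rewrite E in_setU1 in_setU ux !orbT.
Qed.

Section BinarySide.
Variables v w : V.
Hypotheses (evw : e v w)
  (degs : forall u, u \in side v w -> deg e u = 1 \/ deg e u = 3).

Lemma side_odd : odd #|side v w|.
Proof.
move: v w evw degs; apply: side_ind => [a b _ _ ->|a b x y _ _ _ _ _ ->].
  by rewrite cards1.
by rewrite /= oddD => -> ->.
Qed.

(** Each step down accounts for at least two more vertices: the branching vertex and one from the
    nonempty sibling side. *)
Lemma side_depth u : u \in side v w -> 2 * d v u <= #|side v w| + 1.
Proof.
move: u; move: v w evw degs.
apply: side_ind => [a b eab _ ->|a b x y eab ebx eby _ E C Hx Hy] u.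
  by rewrite inE cards1 => /eqP ->; rewrite (dist_edge1 treeE eab).
have [px py] : 0 < #|side b x| /\ 0 < #|side b y|.
  by split; apply/card_gt0P; [exists x | exists y]; apply: side_root.
move=> uab; rewrite (side_dist eab uab) C.
move: uab; rewrite E !in_setU1 in_setU => /or3P [/eqP ->|ux|uy].
- rewrite dist_xx; lia.
- have := Hx u ux; lia.
- have := Hy u uy; lia.
Qed.

(** A side of depth [t] has at most [2 ^ t - 1] vertices; the witness is the deeper of those found
    in the two subsides. *)
Lemma side_exp : exists2 u, u \in side v w & #|side v w| + 1 <= 2 ^ d v u.
Proof.
move: v w evw degs.
apply: side_ind => [a b eab _ ->|a b x y eab ebx eby _ E C [u ux Hu] [z zy Hz]].
  by exists b; rewrite ?in_set1 // cards1 (dist_edge1 treeE eab).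
have uab : u \in side a b by rewrite E in_setU1 in_setU ux orbT.
have zab : z \in side a b by rewrite E in_setU1 in_setU zy !orbT.
have [le|lt] := leqP (d b u) (d b z).
  exists z => //; rewrite C (side_dist eab zab) expnS.
  have : 2 ^ d b u <= 2 ^ d b z by rewrite leq_exp2l.
  lia.
exists u => //; rewrite C (side_dist eab uab) expnS.
have : 2 ^ d b z <= 2 ^ d b u by rewrite leq_exp2l // ltnW.
lia.
Qed.

(** With no leaf before depth [t], the first [t] levels are full and contain
    [1 + 2 + ... + 2 ^ (t - 1)] vertices. *)
Lemma side_full t : (forall u, u \in side v w -> pendant e u -> t <= d v u) ->
  2 ^ t <= #|[set u in side v w | d v u <= t]| + 1.
Proof.
move: t; move: v w evw degs.
apply: side_ind => [a b eab pb ->|a b x y eab ebx eby dis E C Hx Hy] t Ht.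
  have d1 := dist_edge1 treeE eab.
  have := Ht b (set11 b) pb; rewrite d1; case: t {Ht} => [|[|//]] _.
    by rewrite addn1.
  by rewrite addn1 ltnS card_gt0; apply/set0Pn; exists b; rewrite !inE eqxx d1.
case: t Ht => [|t] Ht; first by rewrite addn1.
have sx : side b x \subset side a b.
  by rewrite E; apply: subset_trans (subsetUr _ _); apply: subsetUl.
have sy : side b y \subset side a b.
  by rewrite E; apply: subset_trans (subsetUr _ _); apply: subsetUr.
have {}Hx : 2 ^ t <= #|[set u in side b x | d b u <= t]| + 1.
  apply: Hx => u ux pu; have uab := subsetP sx u ux.
  by have := Ht u uab pu; rewrite (side_dist eab uab).
have {}Hy : 2 ^ t <= #|[set u in side b y | d b u <= t]| + 1.
  apply: Hy => u ux pu; have uab := subsetP sy u ux.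
  by have := Ht u uab pu; rewrite (side_dist eab uab).
set X := [set u in side b x | _] in Hx; set Y := [set u in side b y | _] in Hy.
have sub : b |: (X :|: Y) \subset [set u in side a b | d a u <= t.+1].
  apply/subsetP => u; rewrite in_setU1 in_setU in_set => uXY.
  have uab : u \in side a b.
    case/or3P: uXY => [/eqP ->|/setIdP [ux _]|/setIdP [uy _]].
    - exact: side_root.
    - exact: subsetP sx u ux.
    - exact: subsetP sy u uy.
  rewrite uab (side_dist eab uab) ltnS /=.
  by case/or3P: uXY => [/eqP ->|/setIdP [_ ]|/setIdP [_ ]] //; rewrite dist_xx.
have XY0 : X :&: Y = set0.
  apply/setP => u; rewrite in_setI [u \in X]in_set [u \in Y]in_set in_set0; apply/negP.
  case/andP => /andP [ux _] /andP [uy _].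
  by rewrite (disjointFr dis ux) in uy.
have bXY : b \notin X :|: Y.
  by rewrite in_setU [b \in X]in_set [b \in Y]in_set !(negbTE (side_top _)).
have := subset_leq_card sub; rewrite cardsU1 cardsU XY0 cards0 subn0 bXY expnS.
lia.
Qed.

End BinarySide.
End Sides.

(** * Branches, weights and the centroid in terms of sides *)

Section Weight.
Variables (V : finType) (e : rel V).
Hypothesis treeE : tree e.
Local Notation d := (dist e).
Local Notation side := (side e).

(** A duplicate-free path in [U] starting at [v] must enter the only neighbour [w] of [v] in [U], so
    its end lies on the side of [w]. *)
Lemma subtree_pendant_sub v U : subtree_pendant e v U ->
  exists2 w, e v w & U \subset v |: side v w.
Proof.
case/and3P => vU /andP [_ /forallP /(_ v)] ; rewrite vU => /forallP conU /cards1P [w Nw].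
have /setP /(_ w) := Nw; rewrite !inE eqxx => /andP [wU evw].
exists w => //; apply/subsetP => u uU; rewrite in_setU1.
have := conU u; rewrite uU /=; case/connectP => p0 ep0 ->; case/shortenP: ep0 => -[|x p] /= ep Up _.
  by rewrite eqxx.
case/andP: ep => /and3P [_ xU evx] ep; apply/orP; right.
have /setP /(_ x) := Nw; rewrite !inE xU evx /= => /esym/eqP xw; subst x.
have ep' : path e w p by apply: sub_path ep => a b /and3P [].
have := @dist_uniq_path _ _ treeE v (w :: p); rewrite /= evw ep' => -> //.
exact: dist_le ep' (erefl _).
Qed.

Lemma subtree_pendant_side v w : e v w -> subtree_pendant e v (v |: side v w).
Proof.
move=> evw; set U := v |: side v w; have vU : v \in U by rewrite setU11.
apply/and3P; split=> //; last first.
  apply/cards1P; exists w; apply/setP => u; rewrite in_set in_set1 in_setU1.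
  apply/andP/eqP => [[/orP [/eqP ->|uc] evu]|->]; last by rewrite side_root ?orbT.
    by rewrite (tree_irr treeE) in evu.
  have := side_dist treeE evw uc; rewrite (dist_edge1 treeE evu) => -[] /esym/eqP.
  by rewrite dist_eq0 // => /eqP.
have symU : connect_sym (induced e U).
  apply: sym_connect_sym => a b.
  by rewrite /induced /= (tree_sym treeE a); case: (a \in U); case: (b \in U).
have con u : u \in U -> connect (induced e U) u v.
  elim: {u}(d u v) {-2}u (erefl (d u v)) => [|n IH] u.
    by move/eqP; rewrite dist_eq0 // => /eqP ->; rewrite connect0.
  move=> du uU; have uv : u != v by rewrite -(dist_eq0 treeE) du.
  have [y euy dy] := nbr_toward treeE uv; rewrite du in dy; case: dy => dy.
  (* By [dist_cut], an edge leaving the side ends in [v], which belongs to [U] as well. *)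
  have yU : y \in U.
    rewrite in_setU1; move: uU; rewrite in_setU1 (negbTE uv) /= => uc.
    case: eqVneq => //= yv; rewrite -[_ \in _]negbK -in_setC -sideC //.
    apply/negP => yc; move: uc yc; rewrite !inE => uc yc.
    have := @dist_cut _ _ treeE w v u y; rewrite tree_sym // evw => /(_ isT uc yc).
    rewrite (dist_edge1 treeE euy) -(dist_eq0 treeE) in yv *.
    by rewrite (distC treeE) in yv; lia.
  apply: connect_trans (IH y (esym dy) yU); apply: connect1.
  by rewrite /induced /= uU yU.
apply/andP; split; first by apply/set0Pn; exists v.
apply/forallP => a; apply/implyP => aU; apply/forallP => b; apply/implyP => bU.
by apply: connect_trans (con a aU) _; rewrite symU con.
Qed.

(** For maximality, a larger candidate lies in some [v |: side v x]; as it contains the neighbour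
    [w] of [v], necessarily [x = w]. *)
Lemma branch_side v w : e v w -> branch e v (v |: side v w).
Proof.
move=> evw; apply/maxsetP; split; first exact: subtree_pendant_side.
move=> U /subtree_pendant_sub [x evx sU] sub; apply/eqP; rewrite eqEsubset sub andbT.
suff <- : x = w by [].
have := subsetP (subset_trans sub sU) w; rewrite !in_setU1 side_root // orbT => /(_ isT).
case/orP => [/eqP wv|wx]; first by rewrite wv (tree_irr treeE) in evw.
have := side_dist treeE evx wx; rewrite (dist_edge1 treeE evw) => -[] /esym/eqP.
by rewrite dist_eq0 // => /eqP.
Qed.

(* A vertex of the side is matched with the edge to its parent. *)
Lemma card_edges_side v w : e v w -> #|edges e (v |: side v w)| = #|side v w|.
Proof.
move=> evw; pose par u := odflt v [pick y | e u y && (d y v < d u v)].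
have parP u : u != v -> e u (par u) /\ d u v = (d (par u) v).+1.
  move=> uv; rewrite /par; case: pickP => [y /andP [euy lt]|none] /=.
    by split=> //; have [] := dist_edge treeE v euy; lia.
  by have [y euy dy] := nbr_toward treeE uv; have := none y; rewrite euy dy ltnSn.
have neqv u : u \in side v w -> u != v.
  by apply: contraTneq => ->; apply: side_top.
have parU u : u \in side v w -> par u \in v |: side v w.
  move=> uc; have [eup du] := parP u (neqv u uc); rewrite in_setU1.
  case: eqVneq => //= yv; rewrite -[_ \in _]negbK -in_setC -sideC //.
  apply/negP => yc; move: uc yc; rewrite !inE => uc yc.
  have := @dist_cut _ _ treeE w v u (par u); rewrite tree_sym // evw => /(_ isT uc yc).
  rewrite (dist_edge1 treeE eup) -(dist_eq0 treeE) in yv *.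
  by rewrite (distC treeE) in yv; lia.
have -> : edges e (v |: side v w) = [set [set u; par u] | u in side v w].
  apply/setP => E; apply/imset2P/imsetP => [[x y xU]|[u uc ->]].
    rewrite inE => /andP [yU exy] ->.
    wlog lt : x y xU yU exy / d y v < d x v.
      have [] := dist_edge treeE v exy => dd H; first by apply: H => //; lia.
      by rewrite setUC; apply: H; rewrite 1?tree_sym //; lia.
    have xv : x != v by apply: contraTneq lt => ->; rewrite dist_xx.
    exists x; first by move: xU; rewrite in_setU1 (negbTE xv).
    have [exp dx] := parP x xv; congr [set _; _].
    by apply: (nbr_toward_uniq treeE exy exp lt); rewrite dx.
  have [eup _] := parP u (neqv u uc).
  exists u (par u) => //; first by rewrite in_setU1 uc orbT.
  by rewrite inE parU.
rewrite card_in_imset // => a b ac bc /setP E.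
have [_ da] := parP a (neqv a ac); have [_ db] := parP b (neqv b bc).
have := E a; have := E b; rewrite !in_set2 !eqxx /=.
case/orP => /eqP // ba; case/esym/orP => /eqP // ab.
by move: da db; rewrite -ab -ba; lia.
Qed.

(** Together with [weight_le], this identifies the weight of [v] with the largest size of a side at
    [v]. *)
Lemma side_le_weight v w : e v w -> #|side v w| <= weight e v.
Proof.
move=> evw; rewrite -card_edges_side //.
exact: (@leq_bigmax_cond _ _ (fun U => #|edges e U|)) (branch_side evw).
Qed.

Lemma weight_le v m : (forall w, e v w -> #|side v w| <= m) -> weight e v <= m.
Proof.
move=> le_m; apply/bigmax_leqP => U /maxsetp /subtree_pendant_sub [w evw sub].
apply: leq_trans (le_m w evw); rewrite -card_edges_side //; apply: subset_leq_card.
apply/subsetP => E /imset2P [x y xU]; rewrite inE => /andP [yU exy] ->.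
apply/imset2P; exists x y => //; first exact: (subsetP sub).
by rewrite inE exy andbT (subsetP sub).
Qed.

Lemma side_sub v w x : e v w -> e w x -> x != v -> side w x \proper side v w.
Proof.
move=> evw ewx xv; apply/properP; split; last first.
  by exists w; [apply: side_root | apply: side_top].
by apply/subsetP => u ux; apply/side_childP => //; right; exists x.
Qed.

(** At [w], the side back to [v] has at most half of the vertices, and every other side is properly
    contained in [side v w]. So [w] weighs no more than [v]. *)
Lemma centroid_half v w : v \in centroid e -> e v w -> #|V| <= 2 * #|side v w| ->
  w \in centroid e.
Proof.
rewrite !inE => /forallP minv evw half; apply/forallP => u.
apply: leq_trans (minv u); apply: leq_trans (side_le_weight evw).
apply: weight_le => x ewx; have [->|xv] := eqVneq x v.
  by have := card_sideC treeE evw; lia.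
by apply: ltnW; apply: proper_card; apply: side_sub.
Qed.

(** From any other [x], the side towards [c] contains everything except the side of [c] towards [x],
    so more than half of the vertices, whereas [c] weighs less than half. *)
Lemma centroid_unique c : (forall w, e c w -> 2 * #|side c w| < #|V|) ->
  forall x, x \in centroid e -> x = c.
Proof.
move=> small x; rewrite inE => /forallP /(_ c) le_xc.
have [//|xc] := eqVneq x c; have cx : c != x by rewrite eq_sym.
have [y exy dy] := nbr_toward treeE xc.
have [w ecw dw] := nbr_toward treeE cx.
have sub : side w c \subset side x y.
  apply/subsetP => u; rewrite !inE => uc.
  have dux : d u x = d c u + 1 + d w x by apply: dist_cut => //; rewrite dw.
  have [->//|yx] := dist_edge treeE u exy.
  have duc : d u c = d x u + 1 + d y c by apply: dist_cut; rewrite // ?yx ?dy.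
  by rewrite (distC treeE x u) (distC treeE c u) in dux duc *; lia.
have := subset_leq_card sub; have := side_le_weight exy; have := small w ecw.
have := card_sideC treeE ecw.
have : weight e c <= (#|V|).-1./2 by apply: weight_le => z /small; lia.
lia.
Qed.

End Weight.

(** * Minima over finite sets and the distance between vertex sets *)

Lemma bigminn_le (I : finType) (A : {set I}) (m : nat) (F : I -> nat) (j : I) :
  j \in A -> \big[minn/m]_(i in A) F i <= F j.
Proof.
move=> jA; have := mem_index_enum j; elim: (index_enum I) => // a s IH.
rewrite in_cons big_cons => /orP [/eqP <-|/IH le]; first by rewrite jA geq_minl.
by case: ifP => _ //; apply: leq_trans le; apply: geq_minr.
Qed.

Lemma leq_bigminn (I : finType) (A : {set I}) (k m : nat) (F : I -> nat) :
  k <= m -> (forall i, i \in A -> k <= F i) -> k <= \big[minn/m]_(i in A) F i.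
Proof. by move=> km kF; elim/big_ind: _ => // x y kx ky; rewrite leq_min kx. Qed.

Lemma set_dist_le (V : finType) (e : rel V) (X Y : {set V}) (x y : V) :
  x \in X -> y \in Y -> set_dist e X Y <= dist e x y.
Proof.
by move=> xX yY; apply: leq_trans (bigminn_le _ _ xX) _; apply: bigminn_le.
Qed.

(** The condition [k <= #|V|] handles the default value of the minima. *)
Lemma leq_set_dist (V : finType) (e : rel V) (X Y : {set V}) (k : nat) :
  k <= #|V| -> (forall x y, x \in X -> y \in Y -> k <= dist e x y) ->
  k <= set_dist e X Y.
Proof.
by move=> kV kd; apply: leq_bigminn => // x xX; apply: leq_bigminn => // y; apply: kd.
Qed.

Lemma dist_le_ecc (V : finType) (e : rel V) (x u : V) : dist e u x <= ecc e x.
Proof. exact: (@leq_bigmax _ (fun u => dist e u x)). Qed.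

(** Here [b] and [c] stand for the sizes of the two sides of an edge and [x] for a power of two. As
    [n] is even, [c] is at least [n / 2 + 1]. The conclusion says that the ceiling of [n / 4] is at
    most [x - 1]. *)
Lemma half_arith n b c x : b + c = n -> odd b -> ~~ odd n -> 2 * b < n ->
  c + 1 <= 2 * x -> n + 4 <= x * 4.
Proof. by lia. Qed.

(** * The upper bound for all binary trees *)

Section Upper.
Variables (V : finType) (e : rel V).
Hypothesis bin : binary_tree e.
Let treeE : tree e := bin.1.
Local Notation d := (dist e).
Local Notation side := (side e).

Lemma binary_deg u : deg e u = 1 \/ deg e u = 3.
Proof. by have [/eqP|/bin.2] := boolP (pendant e u); [left | right]. Qed.

(** An edge splits the vertices into two sides of odd size. *)
Lemma binary_tree_even : 1 < #|V| -> ~~ odd #|V|.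
Proof.
case: (pickP V) => [v _|no]; last by rewrite eq_card0.
have : 0 < deg e v by have [->|->] := binary_deg v.
case/card_gt0P => w; rewrite inE => evw _.
have ewv : e w v by rewrite tree_sym.
rewrite -(card_sideC treeE evw) oddD.
by rewrite !(side_odd treeE) // => u _; apply: binary_deg.
Qed.

Lemma center_centroid_bound (n h : nat) : #|V| = n -> 12 <= n ->
  (forall m, n + 4 <= 2 ^ m * 4 -> h <= m) ->
  (2 * set_dist e (center e) (centroid e) + h) * 4 <= n.
Proof.
move=> hV n12 hP; have n_even : ~~ odd n by rewrite -hV binary_tree_even // hV (leq_trans _ n12).
have [v0 _] : exists v : V, v \in V by apply/card_gt0P; rewrite hV; apply: leq_trans n12.
pose c0 := [arg min_(w < v0) ecc e w]; pose t0 := [arg min_(w < v0) weight e w].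
have c0P : c0 \in center e.
  by rewrite inE /c0; case: arg_minnP => // w _ H; apply/forallP => u; apply: H.
have t0P : t0 \in centroid e.
  by rewrite inE /t0; case: arg_minnP => // w _ H; apply/forallP => u; apply: H.
have p0P : (c0, t0) \in setX (center e) (centroid e) by rewrite inE c0P.
(* A closest pair is chosen, so that no step from [v] towards [w] stays in the centroid and no step
   from [w] towards [v] stays in the center. *)
case: (@arg_minnP _ (c0, t0) (mem (setX (center e) (centroid e)))
  (fun p => d p.1 p.2) p0P) => -[w v] /=; rewrite inE /= => /andP [wC vT] minwv.
have {}minwv w' v' : w' \in center e -> v' \in centroid e -> d w v <= d w' v'.
  by move=> w'C v'T; apply: (minwv (w', v')); rewrite inE w'C.
have := set_dist_le e wC vT; set s := set_dist _ _ _ => le_s.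
suff : (2 * d w v + h) * 4 <= n by lia.
have [wv|wv] := eqVneq w v.
  (* If center and centroid meet, only [h <= n %/ 4] remains; it follows from [k + 2 <= 2 ^ k] for
     [k >= 3]. *)
  have : h <= n %/ 4.
    apply: hP; have k3 : 3 <= n %/ 4 by rewrite leq_divRL.
    have : n %/ 4 + 2 <= 2 ^ (n %/ 4).
      elim: (n %/ 4) k3 => // k IH; rewrite leq_eqVlt => /orP [/eqP <- //|/IH].
      by rewrite expnS; lia.
    by have := ltn_ceil n (isT : 0 < 4); lia.
  by rewrite wv dist_xx; have := leq_trunc_div n 4; lia.
have vw : v != w by rewrite eq_sym.
have [v' evv' dv'] := nbr_toward treeE vw.
have [w' eww' dw'] := nbr_toward treeE wv.
have ev'v : e v' v by rewrite tree_sym.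
have wdist a b : d a b = d b a := distC treeE a b.
have small : 2 * #|side v v'| < n.
  rewrite ltnNge -hV; apply/negP => /(centroid_half treeE vT evv') v'T.
  by have := minwv w v' wC v'T; move: dv'; rewrite ![d _ w]wdist; clear; lia.
have degs a b u : u \in side a b -> deg e u = 1 \/ deg e u = 3.
  by move=> _; apply: binary_deg.
have b_odd := side_odd treeE evv' (@degs v v').
have := card_sideC treeE evv'; rewrite hV => b_compl.
have [z zs bz] := side_exp treeE ev'v (@degs v' v).
have ws : w \in side v v' by rewrite inE dv'.
(* The deep vertex [z] lies on the far side of [v], so the path from [w] to it runs through [v], and
   [d v z >= h] because that side has more than half of the vertices. *)
have ecc_h : d w v + h <= ecc e w.
  have dz := side_dist treeE ev'v zs; move: zs ws; rewrite !inE => zs ws.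
  have := dist_cut treeE ev'v ws zs.
  have := dist_le_ecc e w z; rewrite ![d _ w]wdist => ez dwz.
  suff : h <= d v z by move: dv' ez dwz; rewrite ![d _ w]wdist; clear; lia.
  apply: hP; rewrite dz expnS in bz.
  exact: half_arith b_compl b_odd n_even small bz.
have w'C : w' \notin center e.
  by apply/negP => w'C; have := minwv w' v w'C vT; rewrite dw' ltnn.
(* As [w'] is not central, some [u] is farther from it than [ecc e w]. Such a [u] lies beyond [w],
   at distance exactly [ecc e w] from [w]. *)
have [u eccu] : exists u, ecc e w < d u w'.
  have /forallP minw : [forall x, ecc e w <= ecc e x] by rewrite inE in wC.
  have [/existsP //|] := boolP [exists u, ecc e w < d u w'].
  rewrite negb_exists => /forallP le; case/negP: w'C; rewrite inE; apply/forallP => x.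
  apply: leq_trans (minw x); apply/bigmax_leqP => u _; rewrite leqNgt; exact: le.
have ew := dist_le_ecc e w u.
have ew'w : e w' w by rewrite tree_sym.
have us : d w u < d w' u.
  case: (dist_edge treeE u eww') => [dd|->//].
  by move: ew eccu; rewrite ![d u _]wdist dd; clear; lia.
have vs : d w' v < d w v by rewrite dw'.
have dvu := dist_cut treeE eww' us vs.
have dw'u : d w' u = (d w u).+1 by case: (dist_edge treeE u ew'w) us => // ->; clear; lia.
rewrite wdist in dvu; rewrite wdist dw'u in eccu.
have uside : u \in side v v'.
  by rewrite inE; move: (dist_triangle treeE w v' u) dvu dv' dw'; rewrite [d w v]wdist; clear; lia.
(* With [b] the size of [side v v'], this gives [4 * d v u <= 2 * b + 2 <= n], the last step because
   [2 * b < n] and [n] is even. *)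
have := side_depth treeE evv' (@degs v v') uside.
by move: dvu ecc_h eccu small n_even dw'; clear; lia.
Qed.

End Upper.

(** * Contracting maps, longest paths and caterpillars *)

(** The case [f x = f y] admits retractions that collapse part of a tree. *)
Lemma dist_hom (V W : finType) (e : rel V) (e' : rel W) (f : V -> W) :
  tree e -> tree e' -> (forall x y, e x y -> f x = f y \/ e' (f x) (f y)) ->
  forall x y, dist e' (f x) (f y) <= dist e x y.
Proof.
move=> te te' hom x y; have [p [ep _ <- <-]] := dist_path (tree_connect te x y).
elim: p x ep => [|z p IH] x /=; first by rewrite dist_xx.
case/andP => /hom xz /IH le_p; have [->|exz] := xz; first exact: leqW.
apply: leq_trans (dist_triangle te' (f z) _ _) _.
by rewrite (dist_edge1 te' exz) add1n ltnS.
Qed.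

Section Diameter.
Variables (V : finType) (e : rel V).
Hypothesis treeE : tree e.
Local Notation d := (dist e).

Lemma dist_between c u i : i <= d c u -> exists y, d c y = i /\ d c y + d y u = d c u.
Proof.
elim: i => [|i IH] le_i; first by exists c; rewrite dist_xx.
have [y [dcy dy]] := IH (ltnW le_i).
have yu : y != u by rewrite -(dist_eq0 treeE); lia.
have [z eyz dz] := nbr_toward treeE yu; exists z.
have := dist_triangle treeE y c z; have := dist_triangle treeE z c u.
rewrite (dist_edge1 treeE eyz); move: dcy dy dz le_i; clear; lia.
Qed.

(* The edge from [y] towards [z] separates [z] from at least one of [c] and [u]. *)
Lemma dist_diametral c u y z : (forall a b, d a b <= d c u) ->
  d c y + d y u = d c u -> d y z <= maxn (d c y) (d y u).
Proof.
move=> diam dy; have [->|yz] := eqVneq y z; first by rewrite dist_xx.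
have [w eyw dw] := nbr_toward treeE yz.
have dC a b : d a b = d b a := distC treeE a b.
have dwz : d w z < d y z by rewrite dw.
have [yc|yc] := dist_edge treeE c eyw; last first.
  have := @dist_cut _ _ treeE y w c z eyw; rewrite yc => /(_ (ltnSn _) dwz).
  have := diam c z; rewrite [d y c]dC; move: dw dy; clear; lia.
have [yu|yu] := dist_edge treeE u eyw.
  have := dist_triangle treeE w c u; rewrite [d c w]dC.
  rewrite [d c y]dC in dy *; move: dy yu yc; clear; lia.
have := @dist_cut _ _ treeE y w u z eyw; rewrite yu => /(_ (ltnSn _) dwz).
have := diam u z; move: dw dy; clear; lia.
Qed.

End Diameter.

(* Extend the path of a caterpillar as long as an end has a neighbour off the path. *)
Lemma caterpillar_spine (K : finType) (e : rel K) : binary_caterpillar e ->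
  exists x p, [/\ path e x p, uniq (x :: p),
    forall v, v \notin x :: p -> exists2 u, u \in x :: p & e u v,
    forall y, e x y -> y \in p & forall y, e (last x p) y -> y \in x :: p].
Proof.
case=> -[treeE _] [x0 [p0 [ep0 Up0 dom0]]]; have eC := tree_sym treeE.
have {}dom0 v : v \notin x0 :: p0 -> exists2 u, u \in x0 :: p0 & e u v.
  by case/dom0 => u up evu; exists u; rewrite 1?eC.
have: #|K| <= size p0 + #|K| by apply: leq_addl.
elim: {2}#|K| x0 p0 ep0 Up0 dom0 => [|m IH] x p ep Up dom le_m.
  have : size (x :: p) <= #|K| by rewrite -(card_uniqP Up) max_card.
  by rewrite addn0 in le_m; rewrite /= ltnNge le_m.
have [/existsP [y /andP [exy yp]]|nx] := boolP [exists y, e x y && (y \notin p)].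
  apply: (IH y (x :: p)) => /=.
  - by rewrite eC exy.
  - by rewrite -/(uniq (x :: p)) Up inE negb_or yp eq_sym (neq_edge treeE exy).
  - move=> v; rewrite in_cons negb_or => /andP [_ /dom [u up euv]].
    by exists u; rewrite // in_cons up orbT.
  - by rewrite addSn -addnS.
have [/existsP [y /andP [exy yp]]|nl] := boolP [exists y, e (last x p) y && (y \notin x :: p)].
  apply: (IH x (rcons p y)).
  - by rewrite rcons_path ep.
  - by rewrite -rcons_cons rcons_uniq yp.
  - move=> v; rewrite -rcons_cons mem_rcons in_cons negb_or => /andP [_ /dom [u up euv]].
    by exists u; rewrite // mem_rcons in_cons up orbT.
  - by rewrite size_rcons addSn -addnS.
exists x, p; split=> // y exy; apply/negPn/negP => yp.
  by case/existsP: nx; exists y; rewrite exy.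
by case/existsP: nl; exists y; rewrite exy.
Qed.

(** A spine with [D] edges that cannot be extended has [D + 1] vertices. Its ends have no neighbour
    off the spine and each of its [D - 1] inner vertices has at most one, so there are at most
    [2 * D] vertices. *)
Lemma caterpillar_diameter (K : finType) (e : rel K) : binary_caterpillar e ->
  1 < #|K| -> exists a b, #|K| <= 2 * dist e a b.
Proof.
move=> cat K2; have [x [p [ep Up dom endx endl]]] := caterpillar_spine cat.
have bin := cat.1; have treeE := bin.1; have eC := tree_sym treeE.
exists x, (last x p); rewrite dist_uniq_path //.
case/lastP: p => [|p l] in ep Up dom endx endl *.
  case/card_gt1P: K2 => a [b [_ _ ab]].
  have [z zx] : exists z, x != z.
    by have [xa|] := eqVneq x a; [exists b; rewrite xa | exists a].
  by have [y /endx] := nbr_toward treeE zx.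
rewrite last_rcons in endl; rewrite size_rcons.
pose s := x :: rcons p l; pose g u := odflt u [pick v | e u v && (v \notin s)].
suff all_in v : v \in s ++ map g p.
  have : #|K| <= size (s ++ map g p).
    by apply: leq_trans (card_size _); apply: subset_leq_card; apply/subsetP => v _.
  by rewrite size_cat size_map /= size_rcons; lia.
rewrite mem_cat; case: (boolP (v \in s)) => //= vs.
have [u us euv] := dom v vs.
have up : u \in p.
  move: us; rewrite in_cons mem_rcons in_cons => /or3P [/eqP ux|/eqP ul|//].
    by subst u; case/negP: vs; rewrite in_cons endx ?orbT.
  by subst u; case/negP: vs; rewrite endl.
suff -> : v = g u by apply: map_f.
rewrite /g; case: pickP => [w /andP [euw ws]|/(_ v)] /=; last by rewrite euv vs.
apply/eqP; apply: contraT => vw.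
(* The predecessor and successor of [u] on the spine, together with [v] and [w], would give [u]
   degree at least 4. *)
have [a [b [/andP [eua eub] /andP [as_ bs] ab]]] :
    exists a b, [/\ e u a && e u b, (a \in s) && (b \in s) & a != b].
  rewrite /s; case/splitPr: up ep Up => p1 p2.
  rewrite rcons_cat rcons_cons cat_path -cat_cons cat_uniq /= => /and3P [_ eau eu2].
  case/and3P => _ dis _; exists (last x p1), (head l (rcons p2 l)).
  have b2 : head l (rcons p2 l) \in rcons p2 l.
    by case: (p2) => [|? ?]; rewrite inE eqxx.
  have a1 := mem_last x p1.
  split.
  - by rewrite eC eau; case: (p2) eu2 => [|? ?] /= /andP [].
  - by rewrite -cat_cons !mem_cat a1 /= [_ \in u :: _]in_cons b2 !orbT.
  - apply: contra dis => /eqP ab; apply/orP; right; apply/hasP.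
    by exists (last x p1) => //; rewrite ab.
have U4 : uniq [:: a; b; v; w].
  rewrite /= !inE !negb_or ab vw !andbT /=.
  by apply/andP; split; apply/andP; split; [apply: contraNneq vs => <- | apply: contraNneq ws => <-
    | apply: contraNneq vs => <- | apply: contraNneq ws => <-].
have : #|[:: a; b; v; w]| <= deg e u.
  apply: subset_leq_card; apply/subsetP => z; rewrite !inE.
  by case/or4P => /eqP ->.
by rewrite (card_uniqP U4); have [->|->] := binary_deg bin u.
Qed.

(** * Height and balance of rgood trees *)

Section Rgood.
Variables (R : finType) (e : rel R) (r : R).
Hypotheses (good : rgood e r) (R_gt1 : 1 < #|R|).
Local Notation d := (dist e).
Local Notation side := (side e).
Local Notation M := (max_height e r).

Lemma rgood_tree : tree e. Proof. by case: good => -[]. Qed.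

Lemma rgood_deg u : u != r -> deg e u = 1 \/ deg e u = 3.
Proof. by case: good => -[_ [R1|[_ degs]]] _ _; [lia | apply: degs]. Qed.

Lemma height_le_max u : d r u <= M.
Proof. exact: (@leq_bigmax _ (height e r)). Qed.

Lemma rgood_root : exists y1 y2, [/\ e r y1 && e r y2, y1 != y2,
  forall u, e r u -> u = y1 \/ u = y2 & #|R| = (#|side r y1| + #|side r y2|).+1].
Proof.
case: good => -[treeE [R1|[/eqP/cards2P [y1 [y2 [y12 /setP N]]] _]]] _ _; first by lia.
have er1 : e r y1 by have := N y1; rewrite !inE eqxx.
have er2 : e r y2 by have := N y2; rewrite !inE eqxx orbT.
exists y1, y2; rewrite er1 er2; split=> // [u eru|].
  by have := N u; rewrite !inE eru => /esym/orP [] /eqP; [left | right].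
have E : [set: R] = r |: (side r y1 :|: side r y2).
  apply/esym/setP => u; rewrite in_setT in_setU1 in_setU; case: eqVneq => //= ur.
  rewrite eq_sym in ur; have [y ery dy] := nbr_toward treeE ur.
  have uy : u \in side r y by rewrite inE dy.
  have yy : (y == y1) || (y == y2) by have := N y; rewrite !inE ery.
  by case/orP: yy => /eqP <-; rewrite uy ?orbT.
rewrite -cardsT E cardsU1 cardsU disjoint_setI0 ?cards0 ?subn0 ?side_disjoint //.
by rewrite in_setU !(negbTE (side_top _)).
Qed.

Lemma rgood_side_deg y u : e r y -> u \in side r y -> deg e u = 1 \/ deg e u = 3.
Proof.
by move=> ery uy; apply: rgood_deg; apply: contraTneq uy => ->; apply: side_top.
Qed.

(** A vertex of maximum height is pendant, since all its neighbours are nearer to the root; heights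
    of pendant vertices differ by at most one. *)
Lemma rgood_pendant u : pendant e u -> M <= (d r u).+1.
Proof.
move=> pu; have treeE := rgood_tree.
have [w Mw] : {w | M = d r w} by apply: eq_bigmax; lia.
have rw : w != r.
  apply/eqP => wr; rewrite wr dist_xx in Mw.
  have /card_gt1P [a [b [_ _ ab]]] := R_gt1; case/eqP: ab.
  by have := height_le_max a; have := height_le_max b; rewrite Mw !leqn0 !dist_eq0 // =>
    /eqP <- /eqP <-.
have [y ewy dy] := nbr_toward treeE rw.
have pw : pendant e w.
  apply/cards1P; exists y; apply/setP => x; rewrite !inE; apply/idP/eqP => [ewx|->//].
  apply: (nbr_toward_uniq treeE ewx ewy (z := r)); last by rewrite dy.
  have := height_le_max x; rewrite Mw ![d r _]distC //.
  by case: (dist_edge treeE r ewx) => ->; rewrite ?ltnS ?ltnn.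
by case: good => _ /(_ w u pw pu) + _; rewrite /height -Mw addn1.
Qed.

(** No leaf has height below [M - 1], so the levels below [M] are full and hold [2 ^ M - 1]
    vertices; a vertex at height [M] is one more. *)
Lemma rgood_height : 2 ^ M <= #|R|.
Proof.
have treeE := rgood_tree.
have [y1 [y2 [/andP [e1 e2] y12 _ _]]] := rgood_root.
have [w Mw] : {w | M = d r w} by apply: eq_bigmax; lia.
case EM: M => [|m]; first by lia.
pose X y := [set u in side r y | d r u <= m].
have full y : e r y -> 2 ^ m <= #|X y| + 1.
  move=> ery; apply: (side_full treeE ery) => [u|u _ pu]; first exact: rgood_side_deg.
  by have := rgood_pendant pu; rewrite EM.
have subX y : X y \subset side r y by apply/subsetP => u /setIdP [].
have w1 : w \notin r |: (X y1 :|: X y2).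
  have rw : w != r by apply: contra_eq_neq Mw => ->; rewrite dist_xx EM.
  rewrite in_setU1 in_setU (negbTE rw) ![w \in X _]in_set -Mw EM ltnn.
  by rewrite !andbF.
have r1 : r \notin X y1 :|: X y2.
  by rewrite in_setU ![r \in X _]in_set !(negbTE (side_top _)).
have dis : X y1 :&: X y2 = set0.
  apply/eqP; rewrite setI_eq0; apply: disjointW (subX _) (subX _) _.
  exact: side_disjoint.
have := subset_leq_card (subsetT (w |: (r |: (X y1 :|: X y2)))).
rewrite cardsT cardsU1 w1 cardsU1 r1 cardsU dis cards0 subn0.
have := full _ e1; have := full _ e2; rewrite expnS; clear; lia.
Qed.

(** The other side at the root is not a single leaf: a leaf next to the root would force height at
    most 2, leaving at most 3 vertices in [side r y] and too few in total. *)
Lemma rgood_side_small y : 7 <= #|R| -> e r y -> #|side r y| + 3 <= #|R|.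
Proof.
move=> R7 ery; have treeE := rgood_tree.
have [y' ery' cardR] : exists2 y', e r y' & #|R| = (#|side r y| + #|side r y'|).+1.
  have [y1 [y2 [/andP [e1 e2] _ all12 ->]]] := rgood_root.
  by case: (all12 y ery) => ->; [exists y2 | exists y1; rewrite // addnC].
suff : 1 < #|side r y'| by rewrite cardR; clear; lia.
have [/forallP far|] :=
    boolP [forall u, (u \in side r y') && pendant e u ==> (1 < d r u)].
  have : 2 ^ 2 <= #|[set u in side r y' | d r u <= 2]| + 1.
    apply: (side_full treeE ery') => u uy; first exact: rgood_side_deg uy.
    by move=> pu; have := far u; rewrite uy pu.
  have : #|[set u in side r y' | d r u <= 2]| <= #|side r y'|.
    by apply: subset_leq_card; apply/subsetP => u /setIdP [].
  clear; lia.
rewrite negb_forall => /existsP [u]; rewrite negb_imply -leqNgt.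
case/andP => /andP [_ pu] du; have := rgood_pendant pu => le_M.
have [z zy] := side_exp treeE ery (fun u => @rgood_side_deg y u ery).
have : 2 ^ d r z <= 2 ^ 2.
  by rewrite leq_exp2l //; apply: leq_trans (height_le_max z) _; apply: leq_trans le_M _.
move: R7; rewrite cardR; clear; lia.
Qed.

End Rgood.

(* [rK] and [rR] collapse the other half of the glued graph to the common vertex. *)
Lemma glue_maps (V K R : finType) (e : rel V) (eK : rel K) (eR : rel R) (c : K) (r : R) :
  irreflexive eR -> isomorphic e (glue eK eR c r) ->
  exists (iK : K -> V) (iR : R -> V) (rK : V -> K) (rR : V -> R),
    [/\ [/\ iK c = iR r, cancel iK rK & cancel iR rR],
        [/\ forall b, rK (iR b) = c, forall a, rR (iK a) = r &
            forall v, (exists a, v = iK a) \/ (exists b, v = iR b)],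
        {homo iK : a b / eK a b >-> e a b}, {homo iR : a b / eR a b >-> e a b} &
        forall u v, e u v -> (rK u = rK v \/ eK (rK u) (rK v)) /\
                             (rR u = rR v \/ eR (rR u) (rR v))].
Proof.
move=> irrR [phi [psi phiK psiK] homE].
pose jR (b : R) : K + {y : R | y != r} := if insub b is Some y then inr y else inl c.
pose rK v := if phi v is inl a then a else c.
pose rR v := if phi v is inr y then val y else r.
have jRr : jR r = inl c by rewrite /jR insubN // negbK.
have homE' x y : e (psi x) (psi y) = glue eK eR c r x y by rewrite -homE !psiK.
exists (psi \o inl), (psi \o jR), rK, rR; split.
- split=> [|a|b] /=; rewrite ?jRr //; first by rewrite /rK psiK.
  by rewrite /rR psiK /jR; case: insubP => [y _ //|]; rewrite negbK => /eqP.
- split=> [b|a|v] /=; rewrite ?/rK ?/rR ?psiK //; first by rewrite /jR; case: insubP.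
  rewrite -(phiK v); case: (phi v) => [a|y]; [left; exists a | right; exists (val y)] => //=.
  by rewrite /jR valK.
- by move=> a b; rewrite /= homE'.
- move=> a b eab; rewrite /= homE' /jR.
  case: insubP => [a' _ va|/negPn/eqP ar]; case: insubP => [b' _ vb|/negPn/eqP br] /=.
  + by rewrite va vb.
  + by rewrite eqxx va -br.
  + by rewrite eqxx vb -ar.
  + by rewrite ar br irrR in eab.
- move=> u v; rewrite -homE /rK /rR.
  case: (phi u) (phi v) => [a|y] [b|z] /= euv; split; try by [left|right].
  + by case/andP: euv => /eqP -> _; left.
  + by case/andP: euv => _; right.
  + by case/andP: euv => /eqP -> _; left.
  + by case/andP: euv => _; right.
Qed.

(** * Distances, sides and the center in two glued trees *)

Section Crg.
Variables (V K R : finType) (e : rel V) (eK : rel K) (eR : rel R) (c : K) (r : R).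
Hypotheses (treeE : tree e) (treeK : tree eK) (treeR : tree eR).
Variables (iK : K -> V) (iR : R -> V) (rK : V -> K) (rR : V -> R).
Hypotheses (iKR : iK c = iR r) (iKK : cancel iK rK) (iRK : cancel iR rR).
Hypotheses (rKiR : forall b, rK (iR b) = c) (rRiK : forall a, rR (iK a) = r).
Hypothesis cover : forall v, (exists a, v = iK a) \/ (exists b, v = iR b).
Hypothesis homK : {homo iK : a b / eK a b >-> e a b}.
Hypothesis homR : {homo iR : a b / eR a b >-> e a b}.
Hypothesis homr : forall u v, e u v -> (rK u = rK v \/ eK (rK u) (rK v)) /\
                             (rR u = rR v \/ eR (rR u) (rR v)).

Lemma dist_rK u v : dist eK (rK u) (rK v) <= dist e u v.
Proof. by apply: dist_hom => // x y /homr []. Qed.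

Lemma dist_rR u v : dist eR (rR u) (rR v) <= dist e u v.
Proof. by apply: dist_hom => // x y /homr []. Qed.

(** Neither the embedding nor its retraction increases distances. *)
Lemma dist_iK a b : dist e (iK a) (iK b) = dist eK a b.
Proof.
apply/eqP; rewrite eqn_leq; apply/andP; split.
  by apply: dist_hom => // x y /homK; right.
by have := dist_rK (iK a) (iK b); rewrite !iKK.
Qed.

Lemma dist_iR a b : dist e (iR a) (iR b) = dist eR a b.
Proof.
apply/eqP; rewrite eqn_leq; apply/andP; split.
  by apply: dist_hom => // x y /homR; right.
by have := dist_rR (iR a) (iR b); rewrite !iRK.
Qed.

(** A side at the common vertex stays within one part: the retraction onto the other part sends [w]
    to the common vertex, so [w] is no nearer than that vertex to anything in the other part. *)
Lemma glue_side_small m w :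
  #|K| <= m.+1 -> (forall y, eR r y -> #|side eR r y| <= m) -> e (iK c) w ->
  #|side e (iK c) w| <= m.
Proof.
move=> K_le R_le ecw; have ncw := neq_edge treeE ecw.
have [[a wa]|[b wb]] := cover w; subst w.
  apply: (@leq_trans #|[set iK x | x in [set~ c]]|); last first.
    apply: leq_trans (leq_imset_card _ _) _; rewrite cardsC1.
    by move: K_le; case: #|K|.
  apply: subset_leq_card; apply/subsetP => u; rewrite inE.
  have [[x ->]|[y ->]] := cover u; last first.
    rewrite [in X in _ < X]iKR dist_iR; have := dist_rR (iK a) (iR y).
    by rewrite iRK rRiK => le1 lt1; have := leq_ltn_trans le1 lt1; rewrite ltnn.
  rewrite !dist_iK => lt; apply: imset_f; rewrite !inE.
  by apply: contraTneq lt => ->; rewrite dist_xx.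
rewrite iKR in ecw ncw *.
have erb : eR r b.
  by case: (homr ecw) => _; rewrite !iRK => -[rb|//]; rewrite rb eqxx in ncw.
apply: leq_trans (R_le b erb); apply: leq_trans (leq_imset_card iR _).
apply: subset_leq_card; apply/subsetP => u; rewrite inE.
have [[x ->]|[y ->]] := cover u.
  rewrite -[in X in _ < X]iKR dist_iK; have := dist_rK (iR b) (iK x).
  by rewrite iKK rKiR => le1 lt1; have := leq_ltn_trans le1 lt1; rewrite ltnn.
by rewrite !dist_iR => lt; apply: imset_f; rewrite inE.
Qed.

(* [iK y], at distance [i] from the common vertex on a longest path of [K], has
   eccentricity at most [ecc eK c - i]. *)
Lemma glue_center_far i x : (forall u, ecc eK u <= ecc eK c) ->
  i <= ecc eK c - i -> (forall b, dist eR r b + i <= ecc eK c - i) ->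
  x \in center e -> i <= dist e x (iK c).
Proof.
move=> maxc le_i le_h; rewrite inE => /forallP minx.
have [u Du] : {u | ecc eK c = dist eK u c}.
  by apply: eq_bigmax; apply/card_gt0P; exists c.
rewrite (distC treeK) in Du.
have diam a b : dist eK a b <= dist eK c u.
  by rewrite -Du; apply: leq_trans (maxc b); apply: dist_le_ecc.
have le_iu : i <= dist eK c u by rewrite -Du; move: le_i; clear; lia.
have [y [dcy dyu]] := dist_between treeK le_iu.
have ecc_y : ecc e (iK y) <= ecc eK c - i.
  apply/bigmax_leqP => z _; have [[a ->]|[b ->]] := cover z.
    rewrite dist_iK (distC treeK); apply: leq_trans (dist_diametral treeK a diam dyu) _.
    by rewrite geq_max dcy le_i /=; move: Du dyu dcy; clear; lia.
  apply: leq_trans (dist_triangle treeE (iR r) _ _) _.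
  by rewrite -[in X in _ + X]iKR dist_iR dist_iK dcy (distC treeR).
(* A center vertex [x] has eccentricity at most [ecc eK c - i], while the end [iK u] is at distance
   [ecc eK c] from [iK c]. *)
have := dist_triangle treeE x (iK u) (iK c); rewrite dist_iK (distC treeK) -Du.
have := dist_le_ecc e x (iK u); have := minx (iK y).
move: ecc_y le_i; clear; lia.
Qed.

End Crg.

(** * The lower bound for crg trees and the conclusion *)

Lemma crg_center_centroid (V : finType) (e : rel V) (n h l : nat) :
  binary_tree e -> #|V| = n -> ~~ odd n -> 12 <= n -> l = 2 * ceil_divn n 4 + 1 ->
  l < 2 ^ h.+1 -> h <= n %/ 4 -> iso_crg n l e ->
  (n %/ 4 - h) %/ 2 <= set_dist e (center e) (centroid e).
Proof.
move=> bin cardV n_even n12 def_l lt_l h_le [R [eR [r [K [eK [c]]]]]].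
case=> good cardR [cat cardK] maxc iso.
have treeR : tree eR := rgood_tree good; have treeK : tree eK := cat.1.1.
have treeE : tree e := bin.1.
have [iK [iR [rK [rR []]]]] := glue_maps (tree_irr treeR) iso.
case=> iKR iKK iRK [rKiR rRiK cover] homK homR homr.
(* For even [n], subtracting twice the ceiling of [n / 4] leaves twice its floor. The last two
   inequalities keep every side at the common vertex below half of the vertices. *)
have [def_K l7 lt1 lt2] : [/\ #|K| = 2 * (n %/ 4), 7 <= l,
    2 * (2 * (n %/ 4) - 1) < n & 2 * (l - 3) < n].
  by rewrite cardK def_l /ceil_divn; move: n12 n_even; clear; split; lia.
(* The height [M] satisfies [2 ^ M <= l < 2 ^ h.+1]. *)
have M_le b : dist eR r b <= h.
  apply: leq_trans (height_le_max eR r b) _.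
  rewrite -ltnS -(@ltn_exp2l 2) //; apply: leq_ltn_trans lt_l; rewrite -cardR.
  by apply: rgood_height => //; rewrite cardR (leq_trans _ l7).
have ecc_ge : n %/ 4 <= ecc eK c.
  have [|a [b]] := caterpillar_diameter cat; first by rewrite def_K; lia.
  by rewrite def_K leq_pmul2l // => /leq_trans; apply;
    apply: leq_trans (maxc b); apply: dist_le_ecc.
have center_only v : v \in centroid e -> v = iK c.
  apply: centroid_unique => // w ecw; rewrite cardV.
  apply: (@leq_ltn_trans (2 * maxn (2 * (n %/ 4) - 1) (l - 3))); last first.
    by rewrite maxnMr gtn_max lt1 lt2.
  rewrite leq_pmul2l //.
  apply: (glue_side_small treeE treeK treeR iKR iKK iRK rKiR rRiK cover homK homR homr) => //.
    by rewrite def_K; clear; lia.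
  move=> y ery; have R_gt1 : 1 < #|R| by rewrite cardR (leq_trans _ l7).
  have R_ge7 : 7 <= #|R| by rewrite cardR.
  by have := rgood_side_small good R_gt1 R_ge7 ery; rewrite cardR; clear; lia.
apply: leq_set_dist => [|x v xC /center_only ->]; first by rewrite cardV; clear; lia.
(* For [i = (n %/ 4 - h) %/ 2], both side conditions follow from
   [2 * i + h <= n %/ 4 <= ecc eK c]. *)
apply: (glue_center_far treeE treeK treeR iKR iKK iRK cover homK homR homr) => //.
  by move: ecc_ge h_le; clear; lia.
by move=> b; have := M_le b; move: ecc_ge h_le; clear; lia.
Qed.

Theorem corollary3p3 (V : finType) (e : rel V) (n h : nat)
  (hT : binary_tree e) (hV : #|V| = n) (hn : 12 <= n)
  (h_gt0 : 0 < h) (h_ok : ceil_divn n 4 <= 2 ^ h - 1)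
  (h_min : forall k : nat, 0 < k -> ceil_divn n 4 <= 2 ^ k - 1 -> h <= k) :
  ((set_dist e (center e) (centroid e))%:Z
     <= (n %/ 4)%N%:Z - ((n %/ 4 + 1 + h) %/ 2)%N%:Z)%R /\
  (iso_crg n (2 * ceil_divn n 4 + 1) e ->
   ((set_dist e (center e) (centroid e))%:Z
      = (n %/ 4)%N%:Z - ((n %/ 4 + 1 + h) %/ 2)%N%:Z)%R).
Proof.
have n_even : ~~ odd n by rewrite -hV (binary_tree_even hT) // hV (leq_trans _ hn).
have bound : (2 * set_dist e (center e) (centroid e) + h) * 4 <= n.
  apply: (center_centroid_bound hT) => // m le_n; apply: h_min.
    by case: m le_n => // ; move: hn; clear; lia.
  by move: le_n hn; rewrite /ceil_divn; clear; lia.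
have low : iso_crg n (2 * ceil_divn n 4 + 1) e ->
    (n %/ 4 - h) %/ 2 <= set_dist e (center e) (centroid e).
  apply: crg_center_centroid => //; last by move: bound; clear; lia.
  rewrite expnS; move: h_ok hn; rewrite /ceil_divn; clear; lia.
(* With [k = n %/ 4], [bound] gives [h <= k], and then [k - (k + 1 + h) %/ 2 = (k - h) %/ 2]. *)
split=> [|/low].
  by move: bound; clear; lia.
by move: bound; clear; lia.
Qed.
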